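(* Let $n\ge 2$, let $l_\infty$ be a line of $\mathrm{PG}(2,q^n)$, and let $\varphi$ be the associated André-Bruck-Bose map. Let $b$ be a $q$-subline of $\mathrm{PG}(2,q^n)$, not contained in $l_\infty$. Set $\Theta=\langle b\rangle_{q^n}\cap l_\infty$. Then the André-Bruck-Bose representation $\varphi(b\setminus l_\infty)$ is the affine part of a normal rational curve whose order is $\delta=\min\{q,[\Theta:b]\}$. More precisely, if $\delta=1$, then $\varphi(b\setminus l_\infty)$ is an affine line; if $\delta>1$, then $b\cap l_\infty=\emptyset$, and $\varphi(b)$ is a normal rational curve with no points at infinity.
   Context: All dimensions are projective. Field reduction $\mathcal{F}$: identify $\mathrm{PG}(3n-1,q)$ with the projective space of the $\mathbb{F}_q$-vector space $\mathbb{F}_{q^n}^3$; for a point $P=\langle v\rangle_{\mathbb{F}_{q^n}}$ of $\mathrm{PG}(2,q^n)$, $\mathcal{F}(P)$ is the $(n-1)$-dimensional subspace $\{\langle\lambda v\rangle_{\mathbb{F}_q}:\lambda\in\mathbb{F}_{q^n}^*\}$ of $\mathrm{PG}(3n-1,q)$; for a point set $S$, $\mathcal{F}(S)=\{\mathcal{F}(P):P\in S\}$. André-Bruck-Bose map: let $\mathcal{K}$ be a $2n$-dimensional subspace of $\mathrm{PG}(3n-1,q)$ containing $\mathcal{F}(l_\infty)$, so that $\langle\mathcal{F}(l_\infty)\rangle_q$ is a $(2n-1)$-dimensional hyperplane of $\mathcal{K}$ (the hyperplane at infinity). Take $\mathrm{AG}(2,q^n)=\mathrm{PG}(2,q^n)\setminus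 l_\infty$ and $\mathrm{AG}(2n,q)=\mathcal{K}\setminus\langle\mathcal{F}(l_\infty)\rangle_q$. The map $\varphi:\mathrm{AG}(2,q^n)\to\mathrm{AG}(2n,q)$, $\varphi(X)=\mathcal{F}(X)\cap\mathcal{K}$, is a bijection. The affine part of a point set of $\mathcal{K}$ is its intersection with $\mathrm{AG}(2n,q)$; points in $\langle\mathcal{F}(l_\infty)\rangle_q$ are points at infinity. A $q$-subline of $\mathrm{PG}(2,q^n)$ is a set of $q+1$ points $\{\langle xu+yv\rangle_{\mathbb{F}_{q^n}} : (x,y)\in\mathbb{F}_q^2\setminus\{(0,0)\}\}$ with $u,v\in\mathbb{F}_{q^n}^3$ linearly independent over $\mathbb{F}_{q^n}$. $\langle b\rangle_{q^n}$ is the line of $\mathrm{PG}(2,q^n)$ containing $b$. For a point $\Theta\in\langle b\rangle_{q^n}$: if $\Theta\in b$ then $[\Theta:b]=1$; otherwise $[\Theta:b]=[\mathbb{F}_q(\zeta):\mathbb{F}_q]$, where $(1,\zeta)$ are homogeneous coordinates of $\Theta$ on $\langle b\rangle_{q^n}$ with respect to a reference frame of three points of $b$ (receiving coordinates $(1,0),(0,1),(1,1)$); this does not depend on the frame. A normal rational curve of order $t$ is a set of points spanning a $t$-dimensional subspace and equal, in suitable homogeneous coordinates of that subspace, to $\{\langle(y_0^t,y_0^{t-1}y_1,\ldots,y_1^t)\rangle:(y_0,y_1)\in\mathbb{F}_q^2\setminus\{(0,0)\}\}$ (order $1$: a line; order $q$: a set of $q+1$ independent points). *)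

(* Defs.v *)
From HB Require Import structures.
From mathcomp Require Import all_boot all_order all_algebra all_field.
From mathcomp Require Import boolp classical_sets.

Set Implicit Arguments.
Unset Strict Implicit.
Unset Printing Implicit Defensive.

Import GRing.Theory.
Local Open Scope ring_scope.
Local Open Scope classical_set_scope.

(* A projective subspace of projective dimension d is a vector subspace of    *)
(* vector dimension d + 1; in particular points are the 1-dimensional vector  *)
(* subspaces, and a point set is a [set] of such subspaces.                   *)
Section ProjectiveSpace.
Variables (K : fieldType) (V : vectType K).
Implicit Types (U P : {vspace V}) (S C : set {vspace V}).

Definition pts U : set {vspace V} :=
  [set P | \dim P = 1%N /\ (P <= U)%VS].

(* The projective span, as a point set: the intersection of all the subspaces *)
(* containing every member of S (members may be points or larger subspaces).  *)
Definition proj_span S : set {vspace V} :=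
  [set P | \dim P = 1%N /\
           forall U, (forall X, S X -> (X <= U)%VS) -> (P <= U)%VS].

Definition is_nrc (t : nat) C : Prop :=
  exists e : t.+1.-tuple V,
    [/\ free e,
        proj_span C = pts <<e>>%VS
      & C = [set P | exists y : K * K, y != (0, 0) /\
               P = <[\sum_(i < t.+1)
                       (y.1 ^+ (t - i)%N * y.2 ^+ i) *: tnth e i]>%VS]].

End ProjectiveSpace.

Section AndreBruckBose.
Variables (F : finFieldType) (L : fieldExtType F).

(* PG(2, q^n) is the projective space of the L-vector space 'rV[L]_3, and     *)
(* PG(3n-1, q) that of the same triples seen as an F-vector space; the latter *)
(* structure is only available on finite functions.                           *)
Definition redspace : vectType F := {ffun 'I_3 -> L}.

Definition redvec (v : 'rV[L]_3) : redspace := [ffun i => v 0 i].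

Definition redline (v : 'rV[L]_3) (lambda : L) : redspace :=
  redvec (lambda *: v).

Lemma redline_linear (v : 'rV[L]_3) : linear (redline v).
Proof.
move=> a x y; apply/ffunP => i; rewrite !ffunE !mxE.
by rewrite mulrDl scalerAl.
Qed.

HB.instance Definition _ (v : 'rV[L]_3) :=
  GRing.isLinear.Build F L redspace *:%R (redline v) (redline_linear v).

(* Meaningful when P is a point; the value does not depend on the generator   *)
(* of P, as [field_redP] shows.                                               *)
Definition field_red (P : {vspace 'rV[L]_3}) : {vspace redspace} :=
  limg (linfun (redline (vpick P))).

Lemma field_redP (v : 'rV[L]_3) (x : redspace) :
  x \in field_red <[v]>%VS <-> exists lambda : L, x = redvec (lambda *: v).
Proof.
have /vlineP[a va] : vpick <[v]>%VS \in <[v]>%VS by apply: memv_pick.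
split=> [/memv_imgP[l _ ->]|[l ->]].
  by exists (l * a); rewrite lfunE /= /redline va scalerA.
apply/memv_imgP; have [v0|v0] := eqVneq v 0.
  exists 0; first exact: memvf.
  rewrite v0 scaler0 linear0 /redvec.
  by apply/ffunP => i; rewrite !ffunE mxE.
have a0 : a != 0.
  apply: contra_neq v0 => a0; move: va; rewrite a0 scale0r => /eqP.
  by rewrite vpick0 => /eqP v0; apply/eqP; rewrite -memv0 -v0 memv_line.
exists (l / a); first exact: memvf.
by rewrite lfunE /= /redline va scalerA divfK.
Qed.

Definition is_subline (b : set {vspace 'rV[L]_3}) : Prop :=
  exists u v : 'rV[L]_3, free [:: u; v] /\
    b = [set P | exists xy : F * F, xy != (0, 0) /\
                   P = <[xy.1%:A *: u + xy.2%:A *: v]>%VS].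

(* The vectors e1, e2 realize a reference frame of three points of b, which   *)
(* receive the coordinates (1,0), (0,1) and (1,1).                            *)
Definition subline_frame (b : set {vspace 'rV[L]_3}) (e1 e2 : 'rV[L]_3) : Prop :=
  [/\ free [:: e1; e2], b <[e1]>%VS, b <[e2]>%VS & b <[e1 + e2]>%VS].

(* The degree [Theta : b]. Any frame gives the same value, so a classical     *)
(* choice among the possible values is harmless; the default 0 is not reached *)
(* when b is a subline and Theta a point of its line.                         *)
Definition subline_degree (Theta : {vspace 'rV[L]_3})
    (b : set {vspace 'rV[L]_3}) : nat :=
  if `[< b Theta >] then 1%N else
  xget 0%N [set d | exists e1 e2 (zeta : L),
    [/\ subline_frame b e1 e2,
        Theta = <[e1 + zeta *: e2]>%VS
      & d = \dim <<1; zeta>>%VS]].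

Section Affine.
Variables (linf : {vspace 'rV[L]_3}) (K : {vspace redspace}).

Definition abb_map (X : {vspace 'rV[L]_3}) : {vspace redspace} :=
  (field_red X :&: K)%VS.

Definition pts_at_infinity : set {vspace redspace} :=
  proj_span (field_red @` pts linf).

Definition affine_part (C : set {vspace redspace}) : set {vspace redspace} :=
  C `&` (pts K `\` pts_at_infinity).

Definition is_affine_line (A : set {vspace redspace}) : Prop :=
  exists m : {vspace redspace},
    [/\ \dim m = 2%N, (m <= K)%VS, ~ (pts m `<=` pts_at_infinity)
      & A = affine_part (pts m)].

End Affine.

End AndreBruckBose.

(* Main.v *)
Require Import Defs.
From HB Require Import structures.
From mathcomp Require Import all_boot all_order all_algebra all_field.
From mathcomp Require Import boolp classical_sets ring.

(** Let o be a vector generating an affine point and reducing into K. The space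
    K consists of the reductions of the vectors a o + m with a in F and m on the
    line at infinity, so phi maps the point generated by o + m to the F-point
    generated by its reduction (abb_map_affine). Computing phi thus amounts to
    normalising the coefficient of o to 1.

    Choose a frame (e1, e2) of the subline with e2 affine; after rescaling,
    e2 = o. If the subline has a point at infinity, take it for e1
    (subline_generator): the coefficient of o in x e1 + y o is y, an element of
    F, so that phi is linear on the subline and its image is an affine line
    (abb_real).

    Otherwise the point at infinity is m = e1 + zeta o with zeta not in F. The
    point e1 + t o = m + (t - zeta) o is represented by o + (t - zeta)^-1 m, and
    e2 by o. So everything depends on the function t |-> (t - zeta)^-1 on F: it
    is the quotient g / h of a polynomial g over L by a polynomial h over F that
    has no root in F, where h has degree N = min(q, [F(zeta) : F]), g has
    degree N - 1, and the coefficients of g are independent over F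
    (inverse_interpolation). Multiplication by h turns the representing vector
    into a polynomial of degree N in t, with independent vector coefficients,
    whose values are the points of a normal rational curve (curve_is_nrc,
    abb_imaginary). The curve has no point at infinity, because all its points
    have the form o + m' with m' at infinity.

    The degree of Theta is defined from an arbitrary frame of the subline. Each
    frame generates the whole subline (subline_frameE), so the argument can be
    run in the very frame that defines the degree. *)

Set Implicit Arguments.
Unset Strict Implicit.
Unset Printing Implicit Defensive.

Import GRing.Theory.
Local Open Scope ring_scope.
Local Open Scope classical_set_scope.

(** * Rational curves given by a free family *)

Section RationalCurve.
Variables (F : finFieldType) (V : vectType F).
Implicit Types (U : {vspace V}) (E w : nat -> V).

(** In each coordinate the sum is a polynomial of degree less than N that has
    the #|F| >= N elements of F as roots. *)
Lemma moments_eq0 N w : (N <= #|F|)%N ->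
  (forall t : F, \sum_(i < N) t ^+ i *: w i = 0) ->
  forall i, (i < N)%N -> w i = 0.
Proof.
move=> leNq w0 i ltiN; rewrite [w i](coord_vbasis (memvf _)).
apply: big1 => k _; set c := coord _ k.
pose p := \poly_(j < N) c (w j).
have p0 : p = 0.
  apply/eqP/negP => /negP pn0.
  have /(max_poly_roots pn0) : all (root p) (enum F).
    apply/allP => t _; rewrite /root horner_poly.
    have /(congr1 c) := w0 t.
    rewrite /c linear0 linear_sum => E0; rewrite -[X in _ == X]E0.
    by apply/eqP/eq_bigr => j _; rewrite linearZ mulrC.
  rewrite enum_uniq -cardE => /(_ isT) ltqp.
  by have := leq_trans ltqp (size_poly _ _); rewrite ltnNge leNq.
have := congr1 (fun q : {poly F} => q`_i) p0; rewrite coef_poly ltiN coef0.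
by move=> ->; rewrite scale0r.
Qed.

(** The previous lemma modulo U: the components of the w i off U have zero
    moments. *)
Lemma moments_mem U N w : (N <= #|F|)%N ->
  (forall t : F, \sum_(i < N) t ^+ i *: w i \in U) ->
  forall i, (i < N)%N -> w i \in U.
Proof.
move=> leNq wU i ltiN.
suff /eqP : w i - projv U (w i) = 0.
  by rewrite subr_eq0 => /eqP->; apply: memv_proj.
apply: (moments_eq0 (w := fun i => w i - projv U (w i)) leNq) ltiN => t.
under eq_bigr do rewrite scalerBr -linearZ.
by rewrite sumrB -[X in X - _](projv_id (wU t)) linear_sum subrr.
Qed.

Definition curve_vec N E (x y : F) : V :=
  \sum_(i < N.+1) (x ^+ (N - i) * y ^+ i) *: E i.

Definition curve N E : set {vspace V} :=
  [set P | exists2 y : F * F, y != (0, 0) & P = <[curve_vec N E y.1 y.2]>%VS].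

(** The factor 0 ^+ (N - i) vanishes unless i = N, where it is 0 ^+ 0 = 1. *)
Lemma curve_vec0 N E y : curve_vec N E 0 y = y ^+ N *: E N.
Proof.
rewrite /curve_vec big_ord_recr /= subnn expr0 mul1r big1 ?add0r // => i _.
by rewrite expr0n subn_eq0 leqNgt ltn_ord mul0r scale0r.
Qed.

Lemma curve_vec_aff N E x y : x != 0 ->
  curve_vec N E x y = x ^+ N *: curve_vec N E 1 (y / x).
Proof.
move=> x0; rewrite /curve_vec scaler_sumr; apply: eq_bigr => i _.
rewrite scalerA expr1n mul1r expr_div_n; congr (_ *: _).
have -> : x ^+ N = x ^+ (N - i) * x ^+ i by rewrite -exprD subnK ?leq_ord.
rewrite -mulrA; congr (_ * _).
by rewrite mulrCA divff ?expf_neq0// mulr1.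
Qed.

Lemma curve_vec_neq0 N E x y :
  (forall a : 'I_N.+1 -> F, \sum_i a i *: E i = 0 -> forall i, a i = 0) ->
  (x, y) != (0, 0) -> curve_vec N E x y != 0.
Proof.
move=> freeE; apply: contra_neq => /freeE c0.
have := c0 ord_max; rewrite /= subnn expr0 mul1r => /eqP.
rewrite expf_eq0 => /andP[_ /eqP->].
have := c0 ord0; rewrite /= subn0 mulr1 => /eqP.
by rewrite expf_eq0 => /andP[_ /eqP->].
Qed.

(** The only point that needs the bound on N is that the curve spans: the
    parameter (0, 1) gives E N, and once it is subtracted the parameters (1, t)
    give q moments of the N remaining vectors, which recover them. *)
Lemma curve_is_nrc N E : (N <= #|F|)%N ->
  (forall a : 'I_N.+1 -> F, \sum_i a i *: E i = 0 -> forall i, a i = 0) ->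
  is_nrc N (curve N E).
Proof.
move=> leNq freeE; pose e := [tuple E i | i < N.+1].
have eE i : tnth e i = E i by rewrite tnth_mktuple.
have eE' (i : 'I_N.+1) : e`_i = E i by rewrite -eE (tnth_nth 0).
exists e; split.
- by apply/freeP => a; under eq_bigr do rewrite eE'; apply: freeE.
- apply/seteqP; split=> P [dimP PU]; split=> //.
    apply: PU => _ [y _ ->]; rewrite -memvE memv_suml// => i _.
    by rewrite memvZ// -eE memv_span// mem_tnth.
  move=> U CU; apply: (subv_trans PU); apply/span_subvP => _ /tnthP[i ->].
  have EN : E N \in U.
    rewrite memvE; apply: CU; exists (0, 1).
      by rewrite xpair_eqE oner_eq0 andbF.
    by rewrite curve_vec0 expr1n scale1r.
  rewrite eE; have [ltiN|leNi] := ltnP i N; last first.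
    by rewrite [val i](_ : _ = N)//; apply/eqP; rewrite eqn_leq leNi leq_ord.
  apply: (moments_mem leNq) ltiN => t.
  have : curve_vec N E 1 t \in U.
    by rewrite memvE; apply: CU; exists (1, t); rewrite ?xpair_eqE ?oner_eq0.
  rewrite /curve_vec big_ord_recr /= => sumU.
  have := memvB sumU (memvZ (1 ^+ (N - N) * t ^+ N) EN).
  rewrite addrK; congr (_ \in U); apply: eq_bigr => j _.
  by rewrite expr1n mul1r.
- apply/seteqP; split=> P [y]; first by move=> y0 ->; exists y; split=> //;
    congr <[_]>%VS; apply: eq_bigr => i _; rewrite eE.
  move=> [y0 ->]; exists y => //; congr <[_]>%VS.
  by apply: eq_bigr => i _; rewrite eE.
Qed.

End RationalCurve.

(** * Interpolating the inverse of t - zeta over F *)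

Section Polynomial.
Variables (F : finFieldType) (L : fieldExtType F).
Implicit Types (f : {poly F}) (t : F) (zeta : L).

Local Notation "f '^L'" := (map_poly (in_alg L) f)
  (at level 2, format "f '^L'").

Lemma coef_last_neq0 f N : size f = N.+1 -> f`_N != 0.
Proof.
move=> szf; have := lead_coef_eq0 f.
by rewrite lead_coefE szf -size_poly_eq0 szf /= => ->.
Qed.

Lemma root_small_poly zeta f :
  (size f <= \dim <<1; zeta>>%VS)%N -> f^L.[zeta] = 0 -> f = 0.
Proof.
rewrite (dim_Fadjoin 1%AS) dimv1 muln1 => sz /eqP r.
apply/eqP; rewrite -(map_poly_eq0 (in_alg L)); apply/negP => /negP f0.
have /(minPoly_dvdp (K := 1%AS)) : f^L \is a polyOver 1%VS.
  by apply/polyOver1P; exists f.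
move=> /(_ zeta r) /(dvdp_leq f0); rewrite size_minPoly size_map_poly.
by rewrite ltnNge sz.
Qed.

Lemma exists_minPoly zeta : exists2 f : {poly F},
  size f = (\dim <<1; zeta>>%VS).+1 & f^L.[zeta] = 0.
Proof.
have /polyOver1P[f fE] := minPolyOver 1%AS zeta.
exists f; last by rewrite -fE; apply/eqP/root_minPoly.
by rewrite -(size_map_poly (in_alg L)) -fE size_minPoly (dim_Fadjoin 1%AS) dimv1
  muln1.
Qed.

(** The coefficients of the quotient of f - f(zeta) by X - zeta, that is, the
    intermediate values of Horner's scheme. *)
Definition horner_quo zeta f (j : nat) : L := (drop_poly j.+1 f)^L.[zeta].

(** Horner's recurrence, horner_quo j = f_(j+1) + zeta * horner_quo (j+1),
    makes the product telescope. *)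
Lemma horner_quo_divided_difference zeta f t N : size f = N.+1 ->
  (t%:A - zeta) * \sum_(j < N) t ^+ j *: horner_quo zeta f j
  = f.[t]%:A - f^L.[zeta].
Proof.
move=> szf; pose G j := (drop_poly j f)^L.[zeta].
have GS j : G j = (f`_j)%:A + zeta * G j.+1.
  rewrite /G; have -> : drop_poly j f = (f`_j)%:P + drop_poly j.+1 f * 'X.
    by apply/polyP => -[|i]; rewrite !coefE ?addr0 ?add0r// addnS.
  by rewrite rmorphD rmorphM /= map_polyC map_polyX !hornerE mulrC.
(* G is horner_quo shifted by one, so that G 0 is the value of f at zeta. *)
have tele k : (t%:A - zeta) * \sum_(j < k) t ^+ j *: G j.+1 =
    t ^+ k *: G k - G 0%N + \sum_(j < k) (f`_j * t ^+ j)%:A.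
  elim: k => [|k IH]; first by
    rewrite !big_ord0 expr0 scale1r subrr addr0 mulr0.
  rewrite !big_ord_recr mulrDr {}IH /= [G k]GS exprS.
  rewrite -[t ^+ k *: _]mulr_algl -[(t * _) *: _]mulr_algl.
  rewrite -[t ^+ k *: G k.+1]mulr_algl.
  by rewrite -!in_algE !rmorphM /=; ring.
have GN : G N.+1 = 0 by rewrite /G drop_poly_eq0 ?szf// rmorph0 horner0.
have := tele N.+1; rewrite big_ord_recr /= GN !scaler0 addr0 add0r => ->.
by rewrite addrC /G drop_poly0l [f.[t]]horner_coef szf scaler_suml.
Qed.

(** A linear relation between the values at zeta of the polynomials
    drop_poly j.+1 f is a relation between the polynomials themselves, because
    their sizes do not exceed the degree of zeta; and these polynomials are
    independent because their sizes are distinct. *)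
Lemma horner_quo_free zeta f N (a : 'I_N -> F) :
  size f = N.+1 -> (N <= \dim <<1; zeta>>%VS)%N ->
  \sum_j a j *: horner_quo zeta f j = 0 -> forall j, a j = 0.
Proof.
move=> szf leNd a0.
have fN := coef_last_neq0 szf.
pose P := \sum_j a j *: drop_poly j.+1 f.
have P0 : P = 0.
  apply: (@root_small_poly zeta); last first.
    rewrite -[RHS]a0 raddf_sum horner_sum; apply: eq_bigr => j _ /=.
    by rewrite map_polyZ hornerZ /= mulr_algl.
  apply: leq_trans leNd; apply: (leq_trans (size_sum _ _ _)).
  apply/bigmax_leqP => j _; apply: (leq_trans (size_scale_leq _ _)).
  by rewrite size_drop_poly szf subSS leq_subr.
move=> j; have [k] := ubnP (val j).
elim: k j => // k IH j; rewrite ltnS => lejk.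
(* The coefficient of degree N - j.+1 involves only the a i with i <= j. *)
have := congr1 (fun p : {poly F} => p`_(N - j.+1)) P0.
rewrite coef0 coef_sum (bigD1 j)//= big1 ?addr0 => [|i neij]; last first.
  rewrite coefZ coef_drop_poly; have [ltij|leji] := ltnP i j.
    by rewrite IH ?mul0r// (leq_trans ltij).
  rewrite [f`__]nth_default ?mulr0// szf addnS ltnS.
  by rewrite -{1}(subnK (ltn_ord j)) leq_add2l ltn_neqAle eq_sym neij.
rewrite coefZ coef_drop_poly subnK ?ltn_ord// => /eqP.
by rewrite mulf_eq0 (negPf fN) orbF => /eqP.
Qed.

(** The function t |-> (t - zeta)^-1 on F is a quotient of polynomials whose
    denominator has its coefficients in F and degree N. When the degree of zeta
    is at most q, the denominator is the minimal polynomial f of zeta and the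
    numerator is f / (X - zeta). When it exceeds q, take instead f = X^q - X,
    which vanishes on F but not at zeta: on F, the quotient of f - f(zeta) by
    X - zeta equals - f(zeta) / (t - zeta). This is a polynomial, and f + 1,
    which is 1 on F, serves as a denominator of degree q. *)
Lemma inverse_interpolation zeta (N := minn #|F| (\dim <<1; zeta>>%VS)) :
  (1 < N)%N ->
  exists (h : {poly F}) (g : nat -> L),
  [/\ size h = N.+1,
      forall t, (t%:A - zeta) * \sum_(j < N) t ^+ j *: g j = h.[t]%:A
    & forall a : 'I_N -> F, \sum_j a j *: g j = 0 -> forall j, a j = 0].
Proof.
move=> N1; set d := \dim <<1; zeta>>%VS in N N1 *.
have [ledq|ltqd] := leqP d #|F|.
  have [f szf f0] := exists_minPoly zeta.
  have Nd : N = d by apply/minn_idPr.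
  exists f, (horner_quo zeta f); split; first by rewrite Nd.
    by move=> t; rewrite horner_quo_divided_difference ?f0 ?subr0 ?Nd.
  by move=> a; apply: horner_quo_free; rewrite Nd.
have Nq : N = #|F| by apply/minn_idPl/ltnW.
have q1 : (1 < #|F|)%N by rewrite -Nq.
pose f : {poly F} := 'X^#|F| - 'X.
have szf : size f = N.+1.
  by rewrite size_polyDl size_polyXn ?Nq// size_polyN size_polyX.
have fz0 : f^L.[zeta] != 0.
  apply/eqP => /root_small_poly; rewrite szf Nq => /(_ ltqd) /eqP.
  by rewrite -size_poly_eq0 szf.
have ft t : f.[t] = 0 by rewrite !hornerE expf_card subrr.
exists (f + 1), (fun j => - (f^L.[zeta])^-1 * horner_quo zeta f j); split.
- by rewrite size_polyDl// szf size_poly1 ltnS (leq_trans _ N1).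
- move=> t; under eq_bigr do rewrite scalerAr.
  rewrite -mulr_sumr mulrCA horner_quo_divided_difference// hornerD hornerC ft.
  by rewrite add0r scale0r sub0r mulrNN mulVf// scale1r.
- move=> a; under eq_bigr do rewrite scalerAr.
  rewrite -mulr_sumr => /eqP; rewrite mulf_eq0 oppr_eq0 invr_eq0 (negPf fz0) /=.
  by move=> /eqP; apply: horner_quo_free => //; rewrite Nq ltnW.
Qed.

End Polynomial.

(** * Points and lines of a projective space *)

Section Lines.
Variables (K : fieldType) (V : vectType K).
Implicit Types (U : {vspace V}) (u v : V).

Lemma vline_scale (a : K) v : a != 0 -> (<[a *: v]> = <[v]>)%VS.
Proof.
move=> a0; apply/eqP; rewrite eqEsubv -!memvE memvZ ?memv_line//=.
by rewrite -[X in X \in _](scalerK a0) memvZ ?memv_line.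
Qed.

Lemma vline_eq u v : u != 0 -> (<[u]> = <[v]>)%VS ->
  exists2 a : K, a != 0 & u = a *: v.
Proof.
move=> u0 uv; have /vlineP[a ua] : u \in <[v]>%VS by rewrite -uv memv_line.
by exists a => //; apply: contra_neq u0 => a0; rewrite ua a0 scale0r.
Qed.

Lemma vline_of_dim1 U u : \dim U = 1%N -> u != 0 -> u \in U -> U = <[u]>%VS.
Proof.
move=> dU u0 uU; apply/esym/eqP.
by rewrite eqEdim -memvE uU dim_vline u0 dU.
Qed.

Lemma dim1_vline U : \dim U = 1%N -> exists2 u, u != 0 & U = <[u]>%VS.
Proof.
move=> dU; have u0 : vpick U != 0 by rewrite vpick0 -dimv_eq0 dU.
by exists (vpick U) => //; apply: vline_of_dim1 => //; apply: memv_pick.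
Qed.

Lemma pts_vline U u : pts U <[u]>%VS <-> u != 0 /\ u \in U.
Proof.
rewrite /pts /= dim_vline memvE; split=> -[]; first by case: (u != 0).
by move=> ->.
Qed.

Lemma free2E u v : free [:: u; v] = (v != 0) && (u \notin <[v]>%VS).
Proof. by rewrite free_cons span_seq1 seq1_free andbC. Qed.

Lemma free2_eq0 u v (a b : K) :
  free [:: u; v] -> a *: u + b *: v = 0 -> a = 0 /\ b = 0.
Proof.
rewrite free2E => /andP[v0 uv] ab0.
have a0 : a = 0.
  apply: contraNeq uv => a0; rewrite -(scalerK a0 u) memvZ//.
  by move/eqP: ab0; rewrite addr_eq0 => /eqP->; rewrite memvN memvZ ?memv_line.
split=> //; move/eqP: ab0; rewrite a0 scale0r add0r scaler_eq0 (negPf v0) orbF.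
by move/eqP.
Qed.

(** With U the line at infinity, this compares the infinite and affine parts of
    a vector. *)
Lemma comb_in_complement U u v (a b : K) : u \in U -> u != 0 -> v \notin U ->
  a *: u + b *: v = 0 -> a = 0 /\ b = 0.
Proof.
move=> uU u0 vU; rewrite addrC => /free2_eq0 []; last by move=> ->.
by rewrite free2E u0; apply: contra vU => /vlineP[c ->]; rewrite memvZ.
Qed.

Lemma hyperplane_add_line U W v : (U <= W)%VS -> \dim W = (\dim U).+1 ->
  v \in W -> v \notin U -> (U + <[v]>)%VS = W.
Proof.
move=> UW dW vW vU; apply/eqP; rewrite eqEdim subv_add UW -memvE vW dW /=.
rewrite ltn_neqAle dimvS ?addvSl// andbT; apply/negP => /eqP dE.
have : (U == U + <[v]>)%VS by rewrite eqEdim addvSl -dE /=.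
by rewrite eqEsubv subv_add subvv -memvE (negPf vU) !andbF.
Qed.

End Lines.

(** * Frames of a subline *)

Section Subline.
Variables (F : finFieldType) (L : fieldExtType F).
Implicit Types (u v : 'rV[L]_3).

Definition subline u v : set {vspace 'rV[L]_3} :=
  [set P | exists xy : F * F, xy != (0, 0) /\
             P = <[xy.1%:A *: u + xy.2%:A *: v]>%VS].

Lemma subline_scale (a : L) u v : a != 0 ->
  subline (a *: u) (a *: v) = subline u v.
Proof.
move=> a0; apply/seteqP; split=> P [xy [xy0 ->]]; exists xy; split=> //.
  by rewrite -[in RHS](vline_scale _ a0) scalerDr !scalerA ![a * _]mulrC.
by rewrite -[in LHS](vline_scale _ a0) scalerDr !scalerA ![a * _]mulrC.
Qed.

Lemma algA_eq0 (x : F) : (x%:A == 0 :> L) = (x == 0).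
Proof. by rewrite scaler_eq0 oner_eq0 orbF. Qed.

Lemma algA_inj (x y : F) : x%:A = y%:A :> L -> x = y.
Proof. by move/eqP; rewrite -subr_eq0 -scalerBl algA_eq0 subr_eq0 => /eqP. Qed.

(** The relation between e1, e2 and e1 + e2 forces the three factors that carry
    them into the F-span of u and v to agree up to F: by Cramer's rule, e1 and
    e2 are F-combinations of c3 *: u and c3 *: v for one and the same c3 in
    L. *)
Lemma subline_frameE u v e1 e2 : free [:: u; v] ->
  subline_frame (subline u v) e1 e2 -> subline u v = subline e1 e2.
Proof.
move=> fuv [fe [[x1 y1] [_ /= E1]] [[x2 y2] [_ /= E2]] [[x3 y3] [_ /= E3]]].
have e10 : e1 != 0.
  by apply: contraTneq fe => ->; rewrite free2E mem0v andbF.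
have e20 : e2 != 0 by move: fe; rewrite free2E => /andP[].
have e120 : e1 + e2 != 0.
  apply/eqP => e0; have [] := @free2_eq0 _ _ e1 e2 1 1 fe.
    by rewrite !scale1r.
  by move/eqP; rewrite oner_eq0.
have [c1 c10 {}E1] := vline_eq e10 E1.
have [c2 c20 {}E2] := vline_eq e20 E2.
have [c3 c30 {}E3] := vline_eq e120 E3.
have combE (a b : L) : a *: e1 + b *: e2 =
    (a * c1 * x1%:A + b * c2 * x2%:A) *: u +
    (a * c1 * y1%:A + b * c2 * y2%:A) *: v.
  by rewrite E1 E2 !scalerDr !scalerA addrACA -!scalerDl ?mulrA.
pose D : F := x1 * y2 - x2 * y1.
have [eu ev] : c1 * x1%:A + c2 * x2%:A = c3 * x3%:A /\
               c1 * y1%:A + c2 * y2%:A = c3 * y3%:A.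
  have := combE 1 1; rewrite !scale1r !mul1r E3 scalerDr !scalerA => /eqP.
  rewrite -subr_eq0 opprD addrACA -!scalerBl => /eqP /(free2_eq0 fuv)[].
  by move=> /subr0_eq -> /subr0_eq ->.
have D0 : D != 0.
  apply/eqP => D0.
  have D0' : x1%:A * y2%:A - x2%:A * y1%:A = 0 :> L.
    by rewrite -!in_algE -!rmorphM -rmorphB -/D D0 rmorph0.
  have [] := @free2_eq0 _ _ e1 e2 (y2%:A / c1) (- (y1%:A / c2)) fe.
    rewrite combE !mulNr !divfK// [y2%:A * y1%:A]mulrC subrr scale0r addr0.
    by rewrite [y2%:A * _]mulrC [y1%:A * _]mulrC D0' scale0r.
  have [] := @free2_eq0 _ _ e1 e2 (x2%:A / c1) (- (x1%:A / c2)) fe.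
    rewrite combE !mulNr !divfK// [x2%:A * x1%:A]mulrC subrr -opprB D0'.
    by rewrite oppr0 !scale0r addr0.
  move=> /eqP; rewrite mulf_eq0 invr_eq0 (negPf c10) orbF => /eqP x20.
  move=> /eqP; rewrite oppr_eq0 mulf_eq0 invr_eq0 (negPf c20) orbF => /eqP x10.
  move=> /eqP; rewrite mulf_eq0 invr_eq0 (negPf c10) orbF => /eqP y20.
  by move: e20; rewrite E2 x20 y20 !scale0r addr0 scaler0 eqxx.
pose r1 : F := (x3 * y2 - x2 * y3) / D.
pose r2 : F := (x1 * y3 - x3 * y1) / D.
have DL0 : D%:A != 0 :> L by rewrite algA_eq0.
have c1E : c1 = c3 * r1%:A.
  apply: (mulIf DL0); rewrite -mulrA -!in_algE -rmorphM divfK//.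
  rewrite /D !rmorphB !rmorphM /= ?in_algE.
  transitivity (c3 * x3%:A * y2%:A - c3 * y3%:A * x2%:A); last by ring.
  by rewrite -eu -ev; ring.
have c2E : c2 = c3 * r2%:A.
  apply: (mulIf DL0); rewrite -mulrA -!in_algE -rmorphM divfK//.
  rewrite /D !rmorphB !rmorphM /= ?in_algE.
  transitivity (c3 * y3%:A * x1%:A - c3 * x3%:A * y1%:A); last by ring.
  by rewrite -eu -ev; ring.
have r10 : r1 != 0.
  by move: c10; rewrite c1E mulf_eq0 negb_or algA_eq0 => /andP[].
have r20 : r2 != 0.
  by move: c20; rewrite c2E mulf_eq0 negb_or algA_eq0 => /andP[].
have {}combE (x y : F) : x%:A *: e1 + y%:A *: e2 = c3 *:
   ((x * r1 * x1 + y * r2 * x2)%:A *: u + (x * r1 * y1 + y * r2 * y2)%:A *: v).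
  rewrite combE c1E c2E scalerDr !scalerA -!in_algE.
  by congr (_ *: _ + _ *: _); rewrite !rmorphD !rmorphM; ring.
apply/seteqP; split=> P [[X Y] [/= XY0 ->]].
  exists ((X * y2 - Y * x2) / (D * r1), (Y * x1 - X * y1) / (D * r2)) => /=.
  set x := _ / (D * r1); set y := _ / (D * r2).
  have EX : x * r1 * x1 + y * r2 * x2 = X.
    by rewrite /x /y /D; field; rewrite r10 r20 D0.
  have EY : x * r1 * y1 + y * r2 * y2 = Y.
    by rewrite /x /y /D; field; rewrite r10 r20 D0.
  split; last by rewrite combE EX EY vline_scale.
  by apply: contra_neq XY0 => -[x0 y0]; rewrite -EX -EY x0 y0 !mul0r addr0.
exists (X * r1 * x1 + Y * r2 * x2, X * r1 * y1 + Y * r2 * y2) => /=.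
split; last by rewrite combE vline_scale.
apply: contra_neq XY0 => -[EX EY].
have := combE X Y; rewrite EX EY !scale0r addr0 scaler0 => /(free2_eq0 fe).
by move=> [/eqP + /eqP]; rewrite !algA_eq0 => /eqP -> /eqP ->.
Qed.

Lemma subline_swap u v : subline u v = subline v u.
Proof.
by apply/seteqP; split=> P [[x y] [/= xy0 ->]]; exists (y, x);
  rewrite addrC; split=> //; apply: contra_neq xy0 => -[-> ->].
Qed.

(** Together with subline_swap, this lets any prescribed point of a subline be
    the first point of a frame. *)
Lemma subline_generator u v (x y : F) : free [:: u; v] -> x != 0 ->
  subline u v = subline (x%:A *: u + y%:A *: v) v.
Proof.
move=> fuv x0; have xA0 : x%:A != 0 :> L by rewrite algA_eq0.
have [v0 uv] := andP (etrans (esym (free2E u v)) fuv).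
have xy0 z : (x, z) != (0, 0) by rewrite xpair_eqE (negPf x0).
apply: (subline_frameE fuv); split.
- rewrite free2E v0; apply: contra uv => uv; rewrite -(scalerK xA0 u) memvZ//.
  by rewrite -(addrK (y%:A *: v) (x%:A *: u)) memvB ?memvZ ?memv_line.
- by exists (x, y); split; first exact: xy0.
- exists (0, 1); rewrite xpair_eqE oner_eq0 andbF; split=> //=.
  by rewrite !scale1r !scale0r add0r.
- exists (x, y + 1); split; first exact: xy0.
  by rewrite /= -addrA scalerDl scale1r [in RHS]scalerDl scale1r.
Qed.

End Subline.

(** * Field reduction of a subspace *)

Section FieldReduction.
Variables (F : finFieldType) (L : fieldExtType F).
Implicit Types (U : {vspace 'rV[L]_3}) (v w : 'rV[L]_3).

Lemma redvecD v w : redvec (v + w) = redvec v + redvec w.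
Proof. by apply/ffunP => i; rewrite !ffunE mxE. Qed.

Lemma redvecZ (a : F) v : redvec (a%:A *: v) = a *: redvec v.
Proof. by apply/ffunP => i; rewrite !ffunE mxE mulr_algl. Qed.

Lemma redvec0 : redvec (0 : 'rV[L]_3) = 0.
Proof. by apply/ffunP => i; rewrite !ffunE mxE. Qed.

Lemma redvec_inj : injective (@redvec F L).
Proof.
by move=> v w /ffunP vw; apply/rowP => i; have := vw i; rewrite !ffunE.
Qed.

Lemma redvec_surj (x : redspace L) : exists v, x = redvec v.
Proof. by exists (\row_i x i); apply/ffunP => i; rewrite !ffunE mxE. Qed.

Lemma redvec_eq0 v : (redvec v == 0) = (v == 0).
Proof. by rewrite -redvec0 (inj_eq redvec_inj). Qed.

Lemma redvec_sum I (r : seq I) (P : pred I) (f : I -> 'rV[L]_3) :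
  redvec (\sum_(i <- r | P i) f i) = \sum_(i <- r | P i) redvec (f i).
Proof. exact: (big_morph _ redvecD redvec0). Qed.

(** The set of the redvec v with v in U, as mem_red_space shows; the sum over a
    basis exhibits it as a subspace over F. *)
Definition red_space U : {vspace redspace L} :=
  (\sum_(i < \dim U) field_red <[(vbasis U)`_i]>)%VS.

Lemma mem_red_space U v : (redvec v \in red_space U) = (v \in U).
Proof.
apply/memv_sumP/idP => [[vs vsP /esym]|vU].
  move=> /esym vE; suff [w wU E] : exists2 w, w \in U & \sum_i vs i = redvec w.
    by move: vE; rewrite E => /redvec_inj ->.
  elim/big_ind: _ => [|x y [w wU ->] [w' w'U ->]|i _].
  - by exists 0; rewrite ?mem0v ?redvec0.
  - by exists (w + w'); rewrite ?memvD ?redvecD.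
  - have /field_redP[a ->] := vsP i isT; exists (a *: (vbasis U)`_i) => //.
    by rewrite memvZ// vbasis_mem// mem_nth// size_tuple.
exists (fun i => redvec (coord (vbasis U) i v *: (vbasis U)`_i)) => [i _|].
  by apply/field_redP; eexists.
by rewrite -redvec_sum -coord_vbasis.
Qed.

Lemma dim_rV3 : \dim {:'rV[L]_3} = 3%N.
Proof. by rewrite dimvf; apply: (dim_matrix L 1 3). Qed.

(** A sum of \dim U images of L has at most the announced dimension. The bound
    holds for a complement of U too, and the two images span the whole space, so
    that neither inequality can be strict. *)
Lemma dim_red_space U : \dim (red_space U) = (\dim U * \dim {:L})%N.
Proof.
have le U' : (\dim (red_space U') <= \dim U' * \dim {:L})%N.
  apply: leq_trans (dimv_sum_leqif _) _.
  rewrite -[X in (X * _)%N]card_ord -sum_nat_const leq_sum// => i _.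
  exact: leq_trans (leq_addl _ _) (eq_leq (limg_ker_dim _ _)).
apply/eqP; rewrite eqn_leq le /=.
have full : (red_space U + red_space U^C)%VS = fullv.
  apply/vspaceP => x; have [v ->] := redvec_surj x; rewrite memvf.
  have : v \in (U + U^C)%VS by rewrite addv_complf memvf.
  move=> /memv_addP[w wU [w' w'U ->]].
  by rewrite redvecD memv_add ?mem_red_space.
have := leq_trans (dimv_add_leqif (red_space U) (red_space U^C))
                  (leq_add (leqnn _) (le U^C%VS)).
have dimred : \dim {:redspace L} = (3 * \dim {:L})%N.
  by rewrite !dimvf -[X in (X * _)%N](card_ord 3).
rewrite full dimred dimv_compl dim_rV3 mulnBl.
have leU : (\dim U * \dim {:L} <= 3 * \dim {:L})%N.
  by rewrite leq_mul2r -[X in (_ <= X)%N]dim_rV3 dimvS ?subvf ?orbT.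
by rewrite -{1}(subnK leU) addnC leq_add2r.
Qed.

Lemma field_red_sub U P : pts U P -> (field_red P <= red_space U)%VS.
Proof.
move=> [dimP PU]; have [v v0 PE] := dim1_vline dimP.
apply/subvP => x; rewrite {}PE -memvE in PU * => /field_redP[a ->].
by rewrite mem_red_space memvZ.
Qed.

Lemma red_space_sub U (W : {vspace redspace L}) :
  (forall P, pts U P -> (field_red P <= W)%VS) -> (red_space U <= W)%VS.
Proof.
move=> UW; apply/subv_sumP => i _; apply/UW/pts_vline.
have iU : (vbasis U)`_i \in vbasis U by rewrite mem_nth ?size_tuple.
rewrite vbasis_mem//; split=> //.
by apply: free_not0 iU; apply/basis_free/vbasisP.
Qed.

End FieldReduction.

(** * The representation of affine points *)

Section Representation.
Variables (F : finFieldType) (L : fieldExtType F).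
Variables (linf : {vspace 'rV[L]_3}) (K : {vspace redspace L}).
Hypothesis dim_linf : \dim linf = 2%N.
Hypothesis dim_K : \dim K = (2 * \dim {:L}).+1.
Hypothesis field_red_linf : forall P, pts linf P -> (field_red P <= K)%VS.
Implicit Types (m o v w : 'rV[L]_3).

Lemma affine_decomp o w : o \notin linf ->
  exists (a : L) m, m \in linf /\ w = m + a *: o.
Proof.
move=> olinf; have : w \in (linf + <[o]>)%VS.
  by rewrite (hyperplane_add_line (subvf linf)) ?memvf// dim_rV3 dim_linf.
by move=> /memv_addP[m mlinf [_ /vlineP[a ->] ->]]; exists a, m.
Qed.

Lemma pts_at_infinityE : pts_at_infinity linf = pts (red_space linf).
Proof.
apply/seteqP; split=> P [dimP PU]; split=> //.
  by apply: PU => _ [Q Qlinf <-]; apply: field_red_sub.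
move=> U linfU; apply: (subv_trans PU); apply: red_space_sub => Q Qlinf.
by apply: linfU; exists Q.
Qed.

Lemma mem_K_linf m : m \in linf -> redvec m \in K.
Proof. by rewrite -mem_red_space; apply/subvP/red_space_sub. Qed.

(** K contains some reduced vector off the line at infinity; modulo that line it
    is a multiple of o. Rescaling moves neither a point nor a subline, so an
    affine point can be assumed to be generated by a vector reducing into K. *)
Lemma exists_affine_rep o : o \notin linf ->
  exists2 a : L, a != 0 & redvec (a *: o) \in K.
Proof.
move=> olinf; have /subvPn[x xK] : ~~ (K <= red_space linf)%VS.
  by apply/negP => /dimvS; rewrite dim_K dim_red_space dim_linf ltnn.
have [w wE] := redvec_surj x; rewrite {}wE mem_red_space in xK *.
have [a [m [mlinf wE]]] := affine_decomp w olinf => wlinf.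
exists a; first by apply: contraNneq wlinf => a0; rewrite wE a0 scale0r addr0.
have -> : a *: o = w - m by rewrite wE addrC addKr.
by rewrite redvecD memvD// mem_K_linf// memvN.
Qed.

Section Origin.
Variable o : 'rV[L]_3.
Hypotheses (o_affine : o \notin linf) (oK : redvec o \in K).

Lemma K_decomp : K = (red_space linf + <[redvec o]>)%VS.
Proof.
rewrite (hyperplane_add_line (red_space_sub field_red_linf))// ?mem_red_space//.
by rewrite dim_K dim_red_space dim_linf.
Qed.

(** K is the reduction of linf plus the F-line of o, so a multiple
    a *: (o + m) reduces into K only if a is in F. *)
Lemma abb_map_affine m : m \in linf ->
  abb_map K <[o + m]>%VS = <[redvec (o + m)]>%VS.
Proof.
move=> mlinf; apply/eqP; rewrite eqEsubv -memvE memv_cap.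
have -> /= : redvec (o + m) \in K by rewrite redvecD memvD// mem_K_linf.
rewrite andbT; apply/andP; split; last first.
  by apply/field_redP; exists 1; rewrite scale1r.
apply/subvP => x; rewrite memv_cap => /andP[/field_redP[a ->]].
rewrite K_decomp => /memv_addP[y yinf [_ /vlineP[k ->] E]].
have [m' m'E] := redvec_surj y; rewrite m'E in yinf E.
rewrite mem_red_space -redvecZ -redvecD in yinf E.
have aE : a = k%:A.
  apply/eqP; rewrite -subr_eq0; apply: contraNT o_affine => ak0.
  rewrite -(scalerK ak0 o) memvZ// scalerBl.
  have -> : a *: o - k%:A *: o = m' - a *: m.
    move/redvec_inj: E; rewrite scalerDr => /(canRL (addrK _)) ->.
    by rewrite addrAC addrK.
  by rewrite memvB ?memvZ.
by rewrite aE redvecZ memvZ ?memv_line.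
Qed.

Lemma redvec_affine_neq0 m : m \in linf -> redvec (o + m) != 0.
Proof.
move=> mlinf; rewrite redvec_eq0; apply: contraNneq o_affine => /eqP.
by rewrite addr_eq0 => /eqP ->; rewrite memvN.
Qed.

Lemma pts_K_affine m : m \in linf -> pts K <[redvec (o + m)]>%VS.
Proof.
move=> mlinf; apply/pts_vline; split; first exact: redvec_affine_neq0.
by rewrite redvecD memvD// mem_K_linf.
Qed.

Lemma not_at_infinity_affine m : m \in linf ->
  ~ pts_at_infinity linf <[redvec (o + m)]>%VS.
Proof.
move=> mlinf; rewrite pts_at_infinityE => /pts_vline[_].
rewrite mem_red_space => omlinf; move/negP: o_affine; apply.
by rewrite -(addrK m o) memvB.
Qed.

(** * Sublines without points at infinity *)

(** The line spanned by the subline meets linf in m = e1 + zeta *: o, where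
    (e1, o) is a frame of the subline. *)
Section ImaginaryPoint.
Variables (m : 'rV[L]_3) (zeta : L).
Hypotheses (m_linf : m \in linf) (m_neq0 : m != 0).
Local Notation b := (subline (m - zeta *: o) o).
Local Notation N := (minn #|F| (\dim <<1; zeta>>%VS)).
Hypothesis N_gt1 : (1 < N)%N.

(** Since N > 1, zeta is not in F. *)
Lemma affine_coord_neq0 (x y : F) : (x, y) != (0, 0) -> y%:A - x%:A * zeta != 0.
Proof.
apply: contra_neq => /subr0_eq yE.
have x0 : x = 0.
  apply: contraTeq N_gt1 => x0; rewrite -leqNgt geq_min orbC.
  have : zeta \in 1%AS.
    apply/vlineP; exists (y / x); rewrite -in_algE rmorphM fmorphV /= yE.
    by rewrite mulrAC divff ?mul1r// algA_eq0.
  rewrite -adjoin_deg_eq1 => /eqP deg1.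
  by rewrite (dim_Fadjoin 1%AS) deg1 dimv1.
by congr (_, _) => //; apply/(@algA_inj _ L); rewrite yE x0 !scale0r mul0r.
Qed.

(** The infinite part of the point of parameter y, normalised to have o as its
    affine part, is a multiple of m; this is its coefficient. *)
Definition direction (y : F * F) : L := y.1%:A / (y.2%:A - y.1%:A * zeta).

Lemma imaginary_pointE (y : F * F) : y != (0, 0) ->
  (<[y.1%:A *: (m - zeta *: o) + y.2%:A *: o]> = <[o + direction y *: m]>)%VS.
Proof.
case: y => x y xy0; rewrite -[RHS](vline_scale _ (affine_coord_neq0 xy0)) /=.
congr <[_]>%VS; rewrite [RHS]scalerDr scalerA [_ * direction _]mulrC.
rewrite /direction divfK ?affine_coord_neq0//=.
by rewrite scalerBl scalerBr scalerA -addrA addrC; congr (_ + _); apply: addrC.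
Qed.

Lemma direction_linf y : direction y *: m \in linf.
Proof. exact: memvZ. Qed.

Lemma abb_imaginary_point (y : F * F) : y != (0, 0) ->
  abb_map K <[y.1%:A *: (m - zeta *: o) + y.2%:A *: o]>%VS
  = <[redvec (o + direction y *: m)]>%VS.
Proof.
by move=> y0; rewrite imaginary_pointE// abb_map_affine// direction_linf.
Qed.

(** The point of parameter (1, t) is represented by o + (t - zeta)^-1 *: m.
    Clearing the denominator h of inverse_interpolation, which only changes
    this vector by a factor in F, makes its coordinates polynomials in t; E
    collects their coefficients. *)
Lemma abb_image_curve : exists2 E : nat -> redspace L,
  forall a : 'I_N.+1 -> F, \sum_i a i *: E i = 0 -> forall i, a i = 0 &
  abb_map K @` b = curve N E.
Proof.
have [h [g [szh hg freeg]]] := inverse_interpolation N_gt1.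
have hN := coef_last_neq0 szh.
(* The numerator has degree N - 1, whence the 0 in the last vector. *)
pose E i := redvec ((h`_i)%:A *: o + (if (i < N)%N then g i else 0) *: m).
have combE (a : 'I_N.+1 -> F) : \sum_i a i *: E i = redvec
    ((\sum_i a i * h`_i)%:A *: o +
     (\sum_(i < N) a (widen_ord (leqnSn N) i) *: g i) *: m).
  rewrite /E; under eq_bigr do rewrite -redvecZ scalerDr !scalerA.
  rewrite -redvec_sum big_split -!scaler_suml /=.
  congr (redvec (_ *: _ + _ *: _)).
    by rewrite scaler_suml; apply: eq_bigr => i _; rewrite mulr_algl scalerA.
  rewrite big_ord_recr /= ltnn mulr0 addr0; apply: eq_bigr => i _.
  by rewrite ltn_ord mulr_algl.
have freeE (a : 'I_N.+1 -> F) : \sum_i a i *: E i = 0 -> forall i, a i = 0.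
  rewrite combE -redvec0 addrC => /redvec_inj.
  move=> /(comb_in_complement m_linf m_neq0 o_affine).
  move=> [/freeg ag0 /eqP]; rewrite algA_eq0 big_ord_recr /= big1 ?add0r.
    rewrite mulf_eq0 (negPf hN) orbF => /eqP aN i.
    have [ltiN|leNi] := ltnP i N.
      by rewrite -(ag0 (Ordinal ltiN)); congr (a _); apply: val_inj.
    rewrite -[RHS]aN; congr (a _); apply/val_inj/eqP.
    by rewrite eqn_leq leNi leq_ord.
  by move=> i _; rewrite ag0 mul0r.
exists E => //.
have curve_affine t :
    curve_vec N E 1 t = h.[t] *: redvec (o + (t%:A - zeta)^-1 *: m).
  have t0 : t%:A - zeta != 0.
    have := @affine_coord_neq0 1 t.
    by rewrite scale1r mul1r xpair_eqE oner_eq0 => ->.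
  have quotE : h.[t]%:A / (t%:A - zeta) = \sum_(j < N) t ^+ j *: g j.
    by rewrite -hg mulrAC divff ?mul1r.
  rewrite /curve_vec combE -redvecZ scalerDr scalerA quotE horner_coef szh.
  congr (redvec (_%:A *: _ + _ *: _)).
    by apply: eq_bigr => i _; rewrite expr1n mul1r mulrC.
  by apply: eq_bigr => i _; rewrite expr1n mul1r.
have curveE (y : F * F) : y != (0, 0) ->
    (<[redvec (o + direction y *: m)]> = <[curve_vec N E y.1 y.2]>)%VS.
  case: y => x y xy0 /=.
  suff [k kE] : exists k,
      curve_vec N E x y = k *: redvec (o + direction (x, y) *: m).
    rewrite kE vline_scale//.
    apply: contra_neq (curve_vec_neq0 freeE xy0) => k0.
    by rewrite kE k0 scale0r.
  rewrite /direction /=; have [->|x0] := eqVneq x 0.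
    rewrite curve_vec0 /E ltnn !scale0r mul0r scale0r !addr0 redvecZ scalerA.
    by eexists.
  rewrite curve_vec_aff// curve_affine scalerA.
  eexists; congr (_ *: redvec (_ + _ *: _)).
  rewrite -[RHS]invf_div; congr (_^-1).
  have xA0 : x%:A != 0 :> L by rewrite algA_eq0.
  rewrite mulrBl [_ * zeta / _]mulrAC divff// mul1r; congr (_ - _).
  by rewrite -!in_algE rmorphM fmorphV.
apply/seteqP; split=> P.
  move=> [_ [y [y0 ->]] <-]; exists y => //.
  by rewrite abb_imaginary_point// curveE.
move=> [y y0 ->]; rewrite -curveE// -abb_imaginary_point//.
eexists; last by reflexivity.
by exists y.
Qed.

Lemma abb_imaginary : [/\ b `&` pts linf = set0, is_nrc N (abb_map K @` b),
   abb_map K @` b `&` pts_at_infinity linf = set0 & abb_map K @` b `<=` pts K].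
Proof.
have image_affine P : (abb_map K @` b) P ->
    exists2 m', m' \in linf & P = <[redvec (o + m')]>%VS.
  move=> [_ [y [y0 ->]] <-]; exists (direction y *: m).
    exact: direction_linf.
  exact: abb_imaginary_point.
split.
- rewrite -subset0 => P [[y [y0 ->]]]; rewrite imaginary_pointE//.
  move=> /pts_vline[_ omlinf].
  move/negP: o_affine; apply; rewrite -(addrK (direction y *: m) o) memvB//.
  exact: direction_linf.
- have [E freeE ->] := abb_image_curve; apply: curve_is_nrc => //.
  exact: geq_minl.
- rewrite -subset0 => P [/image_affine[m' m'linf ->]].
  exact: not_at_infinity_affine.
- by move=> P /image_affine[m' m'linf ->]; apply: pts_K_affine.
Qed.

End ImaginaryPoint.

(** * Sublines with a point at infinity *)

Section RealPoint.
Variable e : 'rV[L]_3.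
Hypotheses (e_linf : e \in linf) (e_neq0 : e != 0).
Local Notation b := (subline e o).
Local Notation line := (<[redvec e]> + <[redvec o]>)%VS.

Definition line_frame (i : nat) : redspace L :=
  if i is 0 then redvec e else redvec o.

Lemma line_curve_vec x y :
  curve_vec 1 line_frame x y = redvec (x%:A *: e + y%:A *: o).
Proof.
rewrite /curve_vec !big_ord_recr big_ord0 /= add0r expr0 mulr1 mul1r.
by rewrite redvecD !redvecZ.
Qed.

Lemma line_free (a : 'I_2 -> F) :
  \sum_i a i *: line_frame i = 0 -> forall i, a i = 0.
Proof.
rewrite !big_ord_recr big_ord0 /= add0r -!redvecZ -redvecD -redvec0.
move=> /redvec_inj /(comb_in_complement e_linf e_neq0 o_affine)[/eqP + /eqP].
rewrite !algA_eq0 => /eqP a0 /eqP a1 i.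
have [i0|] := eqVneq i ord0.
  by rewrite -a0 i0; congr (a _); apply: val_inj.
by move=> i0; rewrite -a1; congr (a _); apply: val_inj; case: i i0 => -[|[|]].
Qed.

Lemma pts_line : pts line = curve 1 line_frame.
Proof.
apply/seteqP; split=> P.
  move=> [dimP Pline]; have [v v0 PE] := dim1_vline dimP.
  have : v \in line by rewrite memvE -PE.
  move=> /memv_addP[_ /vlineP[x ->] [_ /vlineP[y ->] vE]].
  exists (x, y); last by rewrite line_curve_vec PE vE redvecD !redvecZ.
  by apply: contra_neq v0 => -[x0 y0]; rewrite vE x0 y0 !scale0r addr0.
move=> [[x y] xy0 ->]; apply/pts_vline; split.
  exact: curve_vec_neq0 line_free _.
by rewrite line_curve_vec redvecD !redvecZ memv_add ?memvZ ?memv_line.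
Qed.

Lemma line_sub_K : (line <= K)%VS.
Proof. by rewrite subv_add -!memvE oK mem_K_linf. Qed.

(** The factor that normalises the coefficient y of o is in F, hence the
    representation of the subline is linear. *)
Lemma abb_real_point (x y : F) : y != 0 ->
  abb_map K <[x%:A *: e + y%:A *: o]>%VS
  = <[redvec (x%:A *: e + y%:A *: o)]>%VS.
Proof.
move=> y0; have yA0 : y%:A != 0 :> L by rewrite algA_eq0.
have -> : x%:A *: e + y%:A *: o = y%:A *: (o + (y%:A^-1 * x%:A) *: e).
  by rewrite scalerDr scalerA mulVKf// addrC.
by rewrite vline_scale// redvecZ vline_scale// abb_map_affine ?memvZ.
Qed.

Lemma mem_linf_real (x y : F) : (x%:A *: e + y%:A *: o \in linf) = (y == 0).
Proof.
apply/idP/eqP => [xylinf|->]; last by rewrite !scale0r addr0 memvZ.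
apply: contraNeq o_affine => y0.
have yA0 : y%:A != 0 :> L by rewrite algA_eq0.
rewrite -(scalerK yA0 o) memvZ//.
by rewrite -(addKr (x%:A *: e) (y%:A *: o)) addrC memvB ?memvZ.
Qed.

Lemma abb_real_image :
  abb_map K @` (b `\` pts linf) = affine_part linf K (curve 1 line_frame).
Proof.
apply/seteqP; split=> P.
  move=> [_ [[[x y] [/= xy0 ->]] Qlinf] <-].
  have vnz := curve_vec_neq0 line_free xy0.
  have y0 : y != 0.
    apply/negP => y0; apply: Qlinf; apply/pts_vline.
    by rewrite mem_linf_real y0 -redvec_eq0 -line_curve_vec.
  rewrite abb_real_point//; split.
    by exists (x, y); rewrite ?line_curve_vec.
  split; last first.
    rewrite pts_at_infinityE => /pts_vline[_].
    by rewrite mem_red_space mem_linf_real (negPf y0).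
  apply/pts_vline; split; first by rewrite -line_curve_vec.
  by rewrite redvecD !redvecZ memvD ?memvZ// mem_K_linf.
move=> [[[x y] xy0 ->] [_]]; rewrite /= line_curve_vec pts_at_infinityE => Pinf.
have vnz := curve_vec_neq0 line_free xy0; rewrite line_curve_vec in vnz.
have y0 : y != 0.
  apply/negP => y0; apply: Pinf; apply/pts_vline.
  by rewrite mem_red_space mem_linf_real y0.
exists <[x%:A *: e + y%:A *: o]>%VS; last exact: abb_real_point.
split; first by exists (x, y).
by move=> /pts_vline[_]; rewrite mem_linf_real (negPf y0).
Qed.

Lemma abb_real :
  [/\ exists C, [/\ is_nrc 1 C, C `<=` pts K
         & abb_map K @` (b `\` pts linf) = affine_part linf K C]
    & is_affine_line linf K (abb_map K @` (b `\` pts linf))].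
Proof.
split.
  exists (curve 1 line_frame); split; last exact: abb_real_image.
    by apply: curve_is_nrc line_free; apply/ltnW/card_finNzRing_gt1.
  rewrite -pts_line => P [dimP Pline]; split=> //.
  exact: subv_trans line_sub_K.
exists line; split; last by rewrite pts_line abb_real_image.
- have : free [:: redvec e; redvec o].
    rewrite free2E redvec_eq0; apply/andP; split.
      by apply: contraNneq o_affine => ->; rewrite mem0v.
    apply/negP => /vlineP[k]; rewrite -redvecZ => /redvec_inj eE.
    have [] := @comb_in_complement _ _ _ _ _ 1 (- k%:A) e_linf e_neq0 o_affine.
      by rewrite scale1r scaleNr eE subrr.
    by move/eqP; rewrite oner_eq0.
  by move=> /eqP; rewrite span_cons span_seq1.
- exact: line_sub_K.
- move=> line_inf; have := not_at_infinity_affine (mem0v linf); rewrite addr0.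
  apply; apply: line_inf; apply/pts_vline; split.
    by rewrite redvec_eq0; apply: contraNneq o_affine => ->; rewrite mem0v.
  by rewrite memvE addvSr.
Qed.

End RealPoint.

End Origin.

End Representation.

(** * The representation of a subline *)

Theorem theorem4p2 (F : finFieldType) (L : fieldExtType F) (n : nat)
    (hn : (2 <= n)%N) (hL : \dim {:L} = n)
    (linf : {vspace 'rV[L]_3}) (hlinf : \dim linf = 2%N)
    (K : {vspace redspace L}) (hK : \dim K = (2 * n).+1)
    (hKinf : forall P, pts linf P -> (field_red P <= K)%VS)
    (b : set {vspace 'rV[L]_3}) (hb : is_subline b)
    (hbinf : ~ (b `<=` pts linf))
    (lb : {vspace 'rV[L]_3}) (hlb : \dim lb = 2%N) (hblb : b `<=` pts lb) :
  let phi := abb_map K in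
  let Theta := (lb :&: linf)%VS in
  let delta := minn #|F| (subline_degree Theta b) in
  [/\ (exists C : set {vspace redspace L},
         [/\ is_nrc delta C, C `<=` pts K
           & phi @` (b `\` pts linf) = affine_part linf K C]),
      (delta = 1%N -> is_affine_line linf K (phi @` (b `\` pts linf)))
    & ((1 < delta)%N ->
         [/\ b `&` pts linf = set0,
             is_nrc delta (phi @` b)
           & phi @` b `&` pts_at_infinity linf = set0])].
Proof.
move=> phi Theta delta; rewrite -hL in hK.
have [u [v [fuv bE]]] := hb; rewrite -/(subline u v) in bE.
have q1 : (1 < #|F|)%N := card_finNzRing_gt1 F.
(* As b has an affine point, lb and linf are distinct lines. *)
have dimTheta : \dim Theta = 1%N.
  have full : (lb + linf)%VS = fullv.
    apply/eqP; rewrite eqEsubv subvf; apply/negPn/negP => nfull.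
    apply: hbinf => P bP.
    have [dimP Plb] := hblb _ bP; have [w w0 PE] := dim1_vline dimP.
    rewrite {}PE -memvE in Plb *; apply/pts_vline; split=> //.
    apply: contraNT nfull => wlinf.
    have <- : (linf + <[w]>)%VS = fullv.
      by apply: hyperplane_add_line; rewrite ?subvf ?memvf// dim_rV3 hlinf.
    by rewrite addvC addvS// -memvE.
  have := dimv_sum_cap lb linf; rewrite full dim_rV3 hlb hlinf -/Theta.
  by rewrite -[(2 + 2)%N]/(3 + 1)%N => /addnI.
have Theta_eq w : w != 0 -> w \in lb -> w \in linf -> Theta = <[w]>%VS.
  by move=> w0 wlb wlinf; apply: vline_of_dim1; rewrite ?memv_cap ?wlb.
(* A point of b is at infinity: make it the first point of a frame. *)
have [bTheta|bTheta] := pselect (b Theta).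
  have deltaE : delta = 1%N.
    rewrite /delta /subline_degree; case: asboolP => // _.
    by apply/minn_idPr/ltnW.
  have [e1 [e2 [e10 e1linf bE']]] : exists e1 e2,
      [/\ e1 != 0, e1 \in linf & b = subline e1 e2].
    move: (bTheta); rewrite bE => -[[x y] [/= xy0 ThetaE]].
    set e1 := _ + _ in ThetaE.
    have e10 : e1 != 0.
      by move: dimTheta; rewrite ThetaE dim_vline; case: eqVneq.
    have e1linf : e1 \in linf by rewrite memvE -ThetaE capvSr.
    have [x0|x0] := eqVneq x 0.
      have y0 : y != 0 by apply: contra_neq xy0 => ->; rewrite x0.
      have fvu : free [:: v; u].
        by rewrite (@perm_free _ _ _ [:: u; v])// (perm_catC [:: v] [:: u]).
      exists e1, u; split=> //.
      by rewrite subline_swap (subline_generator x fvu y0) /e1 addrC.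
    by exists e1, v; split=> //; apply: subline_generator.
  have e2linf : e2 \notin linf.
    apply/negP => e2linf; apply: hbinf => P bP; have [dimP _] := hblb _ bP.
    split=> //; move: bP; rewrite bE' => -[xy [_ ->]].
    by rewrite -memvE memvD ?memvZ.
  have [a a0 aK] := exists_affine_rep hlinf hK hKinf e2linf.
  have ae2linf : a *: e2 \notin linf.
    by apply: contra e2linf => ae2; rewrite -(scalerK a0 e2) memvZ.
  have ae10 : a *: e1 != 0 by rewrite scaler_eq0 negb_or a0.
  have := abb_real hlinf hK hKinf ae2linf aK (memvZ a e1linf) ae10.
  by rewrite subline_scale// -bE' deltaE => -[? ?]; split.
(* No point of b is at infinity: any frame realising the degree will do. *)
have [e1 [e2 [zeta [frame_e ThetaE degE]]]] : exists e1 e2 zeta,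
    [/\ subline_frame b e1 e2, Theta = <[e1 + zeta *: e2]>%VS
      & subline_degree Theta b = \dim <<1; zeta>>%VS].
  rewrite /subline_degree; case: asboolP => // _; set S := (S in xget _ S).
  suff : exists d, S d by move=> /(xgetPex 0%N).
  have [v0 uv] := andP (etrans (esym (free2E u v)) fuv).
  have bu : b <[u]>%VS.
    rewrite bE; exists (1, 0); rewrite xpair_eqE oner_eq0.
    by split=> //=; rewrite !scale1r !scale0r addr0.
  have bv : b <[v]>%VS.
    rewrite bE; exists (0, 1); rewrite xpair_eqE oner_eq0 andbF.
    by split=> //=; rewrite !scale1r !scale0r add0r.
  have ulb : u \in lb by rewrite memvE; have [] := hblb _ bu.
  have vlb : v \in lb by rewrite memvE; have [] := hblb _ bv.
  have vlinf : v \notin linf.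
    by apply/negP => vlinf; apply: bTheta; rewrite (Theta_eq v).
  have [c [w [wlinf uE]]] := affine_decomp hlinf u vlinf.
  have wE : w = u - c *: v by rewrite uE addrK.
  exists (\dim <<1; - c>>%VS), u, v, (- c); split=> //.
    split=> //; rewrite bE; exists (1, 1); rewrite xpair_eqE oner_eq0.
    by split=> //=; rewrite !scale1r.
  rewrite scaleNr -wE; apply: Theta_eq => //.
    by apply: contraNneq uv => w0; rewrite uE w0 add0r memvZ ?memv_line.
  by rewrite wE memvB ?memvZ.
have bE' : b = subline e1 e2 by rewrite bE in frame_e *; apply: subline_frameE.
have [fe be1 be2 _] := frame_e.
have e20 : e2 != 0 by move: fe; rewrite free2E => /andP[].
have e2linf : e2 \notin linf.
  apply/negP => e2linf; apply: bTheta.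
  by rewrite (Theta_eq e2)// memvE; have [] := hblb _ be2.
have [a a0 aK] := exists_affine_rep hlinf hK hKinf e2linf.
have ae2linf : a *: e2 \notin linf.
  by apply: contra e2linf => ae2; rewrite -(scalerK a0 e2) memvZ.
pose m := a *: (e1 + zeta *: e2).
have m_linf : m \in linf by rewrite memvZ// memvE -ThetaE capvSr.
have m0 : m != 0.
  rewrite scaler_eq0 negb_or a0 /=.
  by move: dimTheta; rewrite ThetaE dim_vline; case: eqVneq.
(* If zeta were in F, then Theta would be a point of b. *)
have delta1 : (1 < minn #|F| (\dim <<1; zeta>>%VS))%N.
  rewrite leq_min q1 /= (dim_Fadjoin 1%AS) dimv1 muln1 ltn_neqAle andbT eq_sym.
  rewrite adjoin_deg_eq1; apply/negP => /vlineP[k zE]; apply: bTheta.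
  rewrite bE' ThetaE; exists (1, k); rewrite xpair_eqE oner_eq0 scale1r scale1r.
  by rewrite zE.
have := abb_imaginary hlinf hK hKinf ae2linf aK m_linf m0 delta1.
have -> : m - zeta *: (a *: e2) = a *: e1.
  by rewrite /m scalerDr !scalerA [a * zeta]mulrC addrK.
rewrite subline_scale// -bE' -degE -/delta -/phi => -[b_linf nrc_b b_inf b_K].
have bD : b `\` pts linf = b.
  apply/seteqP; split=> P; first by case.
  by move=> bP; split=> // Plinf; have : set0 P by rewrite -b_linf.
split.
- exists (phi @` b); split=> //; rewrite bD.
  apply/seteqP; split=> P; last by case.
  move=> bP; split=> //; split; first exact: b_K.
  by move=> Pinf; have : set0 P by rewrite -b_inf.
- by move=> d1; move: delta1; rewrite -degE -/delta d1.
- by [].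
Qed.
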